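(* Let $\kappa$ be an algebraically closed field and let $W_1,W_2,X$ be finite length connected fs log schemes over $\mathrm{Spec}\,\kappa$, with ghost sheaf monoids $Q_1,Q_2,P$ respectively, and morphisms $f_i:W_i\to X$ inducing $\theta_i=\bar f_i^\flat:P\to Q_i$, $i=1,2$. Let $W_1',W_2',X'$ be log points over $\mathrm{Spec}\,\kappa$ with maps $f_i':W_i'\to X'$, with corresponding monoids $Q_1',Q_2',P'$ and induced maps $\theta_i':P'\to Q_i'$. Suppose given morphisms $g_i:W_i\to W_i'$ and $g:X\to X'$ with $g\circ f_i=f_i'\circ g_i$ for $i=1,2$. Suppose that: (1) $W_1'\times_{X'}^{\mathrm{fs}}W_2'$ is non-empty. (2) The projections $Q_1^\vee\times_{P^\vee}Q_2^\vee\to Q_i^\vee$, $i=1,2$, have image intersecting the interior of $Q_i^\vee$. (3) The maps $\bar g^\flat:P'\to P$ and $\bar g_i^\flat:Q_i'\to Q_i$ are all injective, and the map induced by $\theta=(\theta_1^{\mathrm{gp}},-\theta_2^{\mathrm{gp}})$, $$P^{\mathrm{gp}}/\bar g^\flat((P')^{\mathrm{gp}})\to Q_1^{\mathrm{gp}}/\bar g_1^\flat((Q_1')^{\mathrm{gp}})\oplus Q_2^{\mathrm{gp}}/\bar g_2^\flat((Q_2')^{\mathrm{gp}}),$$ is injective. Then $W_1\times_X^{\mathrm{fs}}W_2$ is non-empty.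
   Context: All log schemes are over an algebraically closed field of characteristic $0$ (so $\kappa$ has characteristic $0$). fs means fine and saturated, and $\times^{\mathrm{fs}}$ is the fibre product in the category of fs log schemes. A log point is $\mathrm{Spec}(Q\to\kappa)$ with $Q$ a sharp fs monoid. The ghost sheaf monoid of a connected finite length log scheme over $\kappa$ is the stalk of its ghost sheaf at its unique point; for a morphism $f$, $\bar f^\flat$ is the induced map of ghost monoids. For a monoid $P$, $P^\vee=\mathrm{Hom}(P,\mathbb N)$; the fibre product $Q_1^\vee\times_{P^\vee}Q_2^\vee$ is taken with respect to the transposes of $\theta_1,\theta_2$. The interior of $Q_i^\vee$ consists of the elements of $Q_i^\vee$ in the interior of the cone $\mathrm{Hom}(Q_i,\mathbb R_{\ge 0})$. *)

(* Defs.v *)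
From HB Require Import structures.
From mathcomp Require Import all_boot all_order all_algebra.
From mathcomp Require Import generic_quotient.
From mathcomp Require Import all_classical all_reals all_analysis.
Set Implicit Arguments.
Unset Strict Implicit.
Unset Printing Implicit Defensive.
Import Order.TTheory GRing.Theory Num.Theory.
Import numFieldNormedType.Exports.
Local Open Scope ring_scope.
Local Open Scope quotient_scope.

Record congruence (M : nmodType) := Congruence {
  cong_rel :> M -> M -> Prop;
  cong_refl : forall x, cong_rel x x;
  cong_sym : forall x y, cong_rel x y -> cong_rel y x;
  cong_trans : forall y x z, cong_rel x y -> cong_rel y z -> cong_rel x z;
  cong_add : forall x y z, cong_rel x y -> cong_rel (x + z) (y + z)
}.

Section CongruenceQuotient.
Variables (M : nmodType) (E : congruence M).

Definition cong_bool : rel M := fun x y => `[< E x y >].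

Lemma cong_bool_refl : reflexive cong_bool.
Proof. by move=> x; apply/asboolP/cong_refl. Qed.

Lemma cong_bool_sym : symmetric cong_bool.
Proof. by move=> x y; apply/asboolP/asboolP; apply: cong_sym. Qed.

Lemma cong_bool_trans : transitive cong_bool.
Proof.
by move=> y x z /asboolP xy /asboolP yz; apply/asboolP; apply: cong_trans xy yz.
Qed.

Canonical cong_equiv :=
  EquivRel cong_bool cong_bool_refl cong_bool_sym cong_bool_trans.

Definition cong_quot := {eq_quot cong_equiv}.
HB.instance Definition _ := Choice.on cong_quot.
HB.instance Definition _ := Quotient.on cong_quot.

Definition cong_pi (x : M) : cong_quot := \pi_cong_quot x.

Lemma cong_piP (x y : M) : cong_pi x = cong_pi y <-> E x y.
Proof.
split=> [/eqP|xy]; first by rewrite eqmodE => /asboolP.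
by apply/eqP; rewrite eqmodE; apply/asboolP.
Qed.

Lemma cong_piK (x : cong_quot) : cong_pi (repr x) = x.
Proof. exact: reprK. Qed.

Lemma cong_reprP (x : M) : E (repr (cong_pi x)) x.
Proof. by apply/cong_piP; rewrite cong_piK. Qed.

Definition cong_quot_zero : cong_quot := cong_pi 0.
Definition cong_quot_add (x y : cong_quot) : cong_quot :=
  cong_pi (repr x + repr y).

Lemma cong_add2 (x x' y y' : M) : E x x' -> E y y' -> E (x + y) (x' + y').
Proof.
move=> xx' yy'; apply: (@cong_trans _ E (x' + y)); first exact: cong_add.
by rewrite [x' + y]addrC [x' + y']addrC; apply: cong_add.
Qed.

Lemma cong_quot_addE (x y : M) :
  cong_quot_add (cong_pi x) (cong_pi y) = cong_pi (x + y).
Proof. by apply/cong_piP/cong_add2; apply: cong_reprP. Qed.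

Lemma cong_quot_addA : associative cong_quot_add.
Proof.
move=> x y z; rewrite -[x]cong_piK -[y]cong_piK -[z]cong_piK.
by rewrite !cong_quot_addE addrA.
Qed.

Lemma cong_quot_addC : commutative cong_quot_add.
Proof. by move=> x y; rewrite /cong_quot_add addrC. Qed.

Lemma cong_quot_add0 : left_id cong_quot_zero cong_quot_add.
Proof. by move=> x; rewrite -[x]cong_piK cong_quot_addE add0r. Qed.

HB.instance Definition _ := GRing.isNmodule.Build cong_quot
  cong_quot_addA cong_quot_addC cong_quot_add0.

Lemma cong_pi_is_additive : nmod_morphism cong_pi.
Proof. by split=> // x y; rewrite -cong_quot_addE. Qed.

HB.instance Definition _ :=
  GRing.isNmodMorphism.Build M cong_quot cong_pi cong_pi_is_additive.

End CongruenceQuotient.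

Section GroupCompletion.
Variable M : nmodType.

Definition gp_rel (x y : M * M) : Prop :=
  exists k, x.1 + y.2 + k = y.1 + x.2 + k.

Lemma gp_rel_refl x : gp_rel x x.
Proof. by exists 0. Qed.

Lemma gp_rel_sym x y : gp_rel x y -> gp_rel y x.
Proof. by case=> k e; exists k. Qed.

Lemma gp_rel_trans y x z : gp_rel x y -> gp_rel y z -> gp_rel x z.
Proof.
case=> k e [l e']; exists (y.1 + y.2 + k + l).
have -> : x.1 + z.2 + (y.1 + y.2 + k + l) = (x.1 + y.2 + k) + (y.1 + z.2 + l).
  by rewrite [LHS](AC (2*4) ((1*4*5)*(3*2*6))).
by rewrite e e' [LHS](AC (3*3) ((4*2)*(1*5*3*6))).
Qed.

Lemma gp_rel_add x y z : gp_rel x y -> gp_rel (x + z) (y + z).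
Proof.
case=> k e; exists (z.1 + z.2 + k).
rewrite /= [LHS](AC ((2*2)*3) ((1*3*7)*(2*4*5*6))) /= e.
by rewrite [RHS](AC ((2*2)*3) ((1*3*7)*(2*4*5*6))).
Qed.

Definition gp_cong :=
  Congruence gp_rel_refl gp_rel_sym gp_rel_trans gp_rel_add.

Definition gp := cong_quot gp_cong.
HB.instance Definition _ := GRing.Nmodule.on gp.

Lemma gp_pair (x : gp) : exists a b, x = cong_pi gp_cong (a, b).
Proof.
by exists (repr x).1, (repr x).2; rewrite -surjective_pairing cong_piK.
Qed.

Definition gp_opp (x : gp) : gp := cong_pi gp_cong ((repr x).2, (repr x).1).

Lemma gp_addN : left_inverse 0 gp_opp +%R.
Proof.
move=> x; rewrite -{2}[x]cong_piK /gp_opp -raddfD; apply/cong_piP.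
by exists 0; rewrite /= !addr0 add0r addrC.
Qed.

HB.instance Definition _ := GRing.Nmodule_isZmodule.Build gp gp_addN.

Definition to_gp (x : M) : gp := cong_pi gp_cong (x, 0).

Lemma to_gp_is_additive : nmod_morphism to_gp.
Proof.
split=> [|x y]; first exact: raddf0.
by rewrite /to_gp -raddfD; congr cong_pi; congr pair; rewrite addr0.
Qed.

HB.instance Definition _ := GRing.isNmodMorphism.Build M gp to_gp to_gp_is_additive.

End GroupCompletion.

Section GroupCompletionMap.
Variables (M N : nmodType) (f : {additive M -> N}).

Definition gp_map (x : gp M) : gp N :=
  cong_pi (gp_cong N) (f (repr x).1, f (repr x).2).

Lemma gp_mapE (a b : M) :
  gp_map (cong_pi (gp_cong M) (a, b)) = cong_pi (gp_cong N) (f a, f b).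
Proof.
apply/cong_piP; have [k e] := cong_reprP (gp_cong M) (a, b).
by exists (f k); rewrite /= -!raddfD e.
Qed.

Lemma gp_map_is_additive : nmod_morphism gp_map.
Proof.
split=> [|x y]; first by rewrite gp_mapE !raddf0.
have [a [b ->]] := gp_pair x; have [c [d ->]] := gp_pair y.
rewrite -[X in gp_map X]raddfD !gp_mapE -[RHS]raddfD.
by congr cong_pi; rewrite /= !raddfD.
Qed.

HB.instance Definition _ :=
  GRing.isNmodMorphism.Build (gp M) (gp N) gp_map gp_map_is_additive.

End GroupCompletionMap.

Section Coker.
Variables (U V : zmodType) (f : {additive U -> V}).

Definition coker_rel (x y : V) : Prop := exists u, x - y = f u.

Lemma coker_rel_refl x : coker_rel x x.
Proof. by exists 0; rewrite subrr raddf0. Qed.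

Lemma coker_rel_sym x y : coker_rel x y -> coker_rel y x.
Proof. by case=> u e; exists (- u); rewrite raddfN -e opprB. Qed.

Lemma coker_rel_trans y x z : coker_rel x y -> coker_rel y z -> coker_rel x z.
Proof.
by case=> u e [v e']; exists (u + v); rewrite raddfD -e -e' addrA subrK.
Qed.

Lemma coker_rel_add x y z : coker_rel x y -> coker_rel (x + z) (y + z).
Proof. by case=> u e; exists u; rewrite -e opprD addrACA subrr addr0. Qed.

Definition coker_cong :=
  Congruence coker_rel_refl coker_rel_sym coker_rel_trans coker_rel_add.

Definition coker := cong_quot coker_cong.
HB.instance Definition _ := GRing.Nmodule.on coker.

Definition coker_opp (x : coker) : coker := cong_pi coker_cong (- repr x).

Lemma coker_addN : left_inverse 0 coker_opp +%R.
Proof.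
move=> x; rewrite -{2}[x]cong_piK /coker_opp -raddfD addNr; exact: raddf0.
Qed.

HB.instance Definition _ := GRing.Nmodule_isZmodule.Build coker coker_addN.

End Coker.

Section CokerMap.
Variables (U V U' V' : zmodType).
Variables (f : {additive U -> V}) (f' : {additive U' -> V'}) (h : V -> V').

(* Induced map on quotients; meaningful when [h] is additive and maps the image
   of [f] into that of [f'], see [coker_mapE]. *)
Definition coker_map (x : coker f) : coker f' := cong_pi (coker_cong f') (h (repr x)).

Lemma coker_mapE (k : U -> U') (v : V) : {morph h : x y / x - y} ->
  (forall u, h (f u) = f' (k u)) ->
  coker_map (cong_pi (coker_cong f) v) = cong_pi (coker_cong f') (h v).
Proof.
move=> hB hf; apply/cong_piP; have [u e] := cong_reprP (coker_cong f) v.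
by exists (k u); rewrite -hf -e hB.
Qed.

End CokerMap.

Definition integral_monoid (M : nmodType) : Prop :=
  forall z : M, injective (fun x => x + z).

Definition fg_monoid (M : nmodType) : Prop :=
  exists (n : nat) (g : 'I_n -> M),
    forall x, exists c : 'I_n -> nat, x = \sum_(i < n) g i *+ c i.

Definition saturated_monoid (M : nmodType) : Prop :=
  forall (x : gp M) (n : nat), (0 < n)%N ->
    (exists y, x *+ n = to_gp y) -> exists z, x = to_gp z.

Definition fs_monoid (M : nmodType) : Prop :=
  [/\ integral_monoid M, fg_monoid M & saturated_monoid M].

Definition sharp_monoid (M : nmodType) : Prop :=
  forall x y : M, x + y = 0 -> x = 0.

Definition dual (M : nmodType) := {additive M -> nat}.

Definition dual_fibre_product (P Q1 Q2 : nmodType)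
    (theta1 : {additive P -> Q1}) (theta2 : {additive P -> Q2}) :
    set (dual Q1 * dual Q2) :=
  [set h : dual Q1 * dual Q2 | forall p, h.1 (theta1 p) = h.2 (theta2 p)].

Section DualCone.
Variables (R : realType) (Q : nmodType).

Definition real_homs : set {ptws Q -> R} := [set h | nmod_morphism h].

(* The topology of [Hom(Q, R)] is the one induced by pointwise convergence; for
   finitely generated [Q] it is that of the finite-dimensional vector space. *)
Definition dual_cone : set (subspace real_homs) :=
  [set h | real_homs h /\ forall q, 0 <= h q].

Definition interior_dual : set (dual Q) :=
  [set h | (dual_cone°)%classic (fun q => (h q)%:R : R)].

End DualCone.

Arguments interior_dual R {Q} _.

Definition finite_dim (k : fieldType) (A : lmodType k) : Prop :=
  exists (n : nat) (b : 'I_n -> A),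
    forall a, exists c : 'I_n -> k, a = \sum_(i < n) c i *: b i.

Definition local_ring (A : comUnitRingType) : Prop :=
  forall a b : A,
    a + b \is a GRing.unit -> (a \is a GRing.unit) || (b \is a GRing.unit).

(* [alpha] turns addition of [M] into multiplication of [A] and restricts to a
   bijection from the preimage of the units of [A] onto the units of [A]. *)
Record log_structure (k : fieldType) (A : comUnitAlgType k) (M : nmodType)
    (alpha : M -> A) : Prop := LogStructure {
  log_alpha0 : alpha 0 = 1;
  log_alphaD : forall m n, alpha (m + n) = alpha m * alpha n;
  log_alpha_unit : forall a, a \is a GRing.unit -> exists! m, alpha m = a
}.

(* [beta : L -> M] is a chart when the induced map from the log structure
   associated to [alpha \o beta], that is, from the pushout of
   [L <- (alpha \o beta)^-1(A^x) -> A^x], to [M] is bijective.  Here [A^x] is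
   identified with the [s : M] such that [alpha s] is a unit. *)
Record is_chart (k : fieldType) (A : comUnitAlgType k) (M : nmodType)
    (alpha : M -> A) (L : nmodType) (beta : {additive L -> M}) : Prop := IsChart {
  chart_surj : forall m, exists l s,
    alpha s \is a GRing.unit /\ m = beta l + s;
  chart_inj : forall l l' s s',
    alpha s \is a GRing.unit -> alpha s' \is a GRing.unit ->
    beta l + s = beta l' + s' ->
    exists a b, [/\ alpha (beta a) \is a GRing.unit,
                    alpha (beta b) \is a GRing.unit,
                    l + a = l' + b & s + beta b = s' + beta a]
}.

Definition fs_log_structure (k : fieldType) (A : comUnitAlgType k)
    (M : nmodType) (alpha : M -> A) : Prop :=
  log_structure alpha /\
  exists (L : nmodType) (beta : {additive L -> M}),
    fs_monoid L /\ is_chart alpha beta.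

(* A connected fs log scheme of finite length over an algebraically closed
   field [k].  Its underlying scheme is [Spec A] with [A] a finite-dimensional
   local [k]-algebra with residue field [k].  As [A] is strictly henselian, an
   etale sheaf on [Spec A] is determined by its global sections, so the log
   structure amounts to a monoid homomorphism [alpha : M -> A], and it has an
   fs chart etale locally iff it has one globally. *)
Record conn_log_scheme (k : fieldType) := ConnLogScheme {
  cring : comUnitAlgType k;
  cmon : nmodType;
  calpha : cmon -> cring;
  cring_finite : finite_dim cring;
  cring_local : local_ring cring;
  calpha_fs : fs_log_structure calpha
}.

Arguments calpha {k} c _ : rename.

Section ConnMor.
Variable k : fieldType.
Implicit Types W X Y : conn_log_scheme k.

Record conn_mor W X := ConnMor {
  cmor_ring : {lrmorphism cring X -> cring W};
  cmor_mon : {additive cmon X -> cmon W};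
  cmor_alpha : forall m, calpha W (cmor_mon m) = cmor_ring (calpha X m)
}.

Lemma conn_mor_ext W X (f g : conn_mor W X) :
  cmor_ring f =1 cmor_ring g -> cmor_mon f =1 cmor_mon g -> f = g.
Proof.
case: f g => fr fm fa [gr gm ga] /= er em.
have {}er : fr = gr.
  case: fr gr er {fa ga} => fr [[fa] [[f1 fM]] [fZ]] [gr [[ga] [[g1 gM]] [gZ]]].
  move=> /= /funext er; subst gr.
  by rewrite (Prop_irrelevance fa ga) (Prop_irrelevance f1 g1)
             (Prop_irrelevance fM gM) (Prop_irrelevance fZ gZ).
have {}em : fm = gm.
  case: fm gm em {fa ga} => fm [[fa]] [gm [[ga]]] /= /funext em.
  by subst gm; rewrite (Prop_irrelevance fa ga).
by subst gr gm; rewrite (Prop_irrelevance fa ga).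
Qed.

Lemma conn_id_alpha W m : calpha W (idfun m) = idfun (calpha W m).
Proof. by []. Qed.

Definition conn_id W : conn_mor W W := ConnMor (@conn_id_alpha W).

Lemma conn_comp_alpha W X Y (g : conn_mor X Y) (f : conn_mor W X) m :
  calpha W ((cmor_mon f \o cmor_mon g) m) =
  (cmor_ring f \o cmor_ring g) (calpha Y m).
Proof. by rewrite /= !cmor_alpha. Qed.

Definition conn_comp W X Y (g : conn_mor X Y) (f : conn_mor W X) :
  conn_mor W Y := ConnMor (conn_comp_alpha g f).

Definition conn_iso W X : Prop :=
  exists (f : conn_mor W X) (g : conn_mor X W),
    conn_comp g f = conn_id W /\ conn_comp f g = conn_id X.

End ConnMor.

Section Ghost.
Variables (k : fieldType) (W : conn_log_scheme k).

Definition ghost_rel (m n : cmon W) : Prop :=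
  exists2 s, calpha W s \is a GRing.unit & m + s = n.

Lemma ghost_rel_refl m : ghost_rel m m.
Proof.
have [ls _] := calpha_fs W.
by exists 0; rewrite ?addr0 // (log_alpha0 ls) unitr1.
Qed.

Lemma ghost_rel_sym m n : ghost_rel m n -> ghost_rel n m.
Proof.
case=> s us <-; have [ls _] := calpha_fs W.
have [t [at_ _]] : exists! t, calpha W t = (calpha W s)^-1.
  by apply: (log_alpha_unit ls); rewrite unitrV.
exists t; first by rewrite at_ unitrV.
suff st0 : s + t = 0 by rewrite -addrA st0 addr0.
have [z [_ zu]] := log_alpha_unit ls (unitr1 _).
by rewrite -(zu 0 (log_alpha0 ls)) -(zu (s + t)) // (log_alphaD ls) at_ divrr.
Qed.

Lemma ghost_rel_trans n m p : ghost_rel m n -> ghost_rel n p -> ghost_rel m p.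
Proof.
case=> s us <- [t ut <-]; have [ls _] := calpha_fs W.
by exists (s + t); rewrite ?addrA // (log_alphaD ls) unitrM us.
Qed.

Lemma ghost_rel_add m n p : ghost_rel m n -> ghost_rel (m + p) (n + p).
Proof. by case=> s us <-; exists s => //; rewrite addrAC. Qed.

Definition ghost_cong :=
  Congruence ghost_rel_refl ghost_rel_sym ghost_rel_trans ghost_rel_add.

Definition ghost := cong_quot ghost_cong.
HB.instance Definition _ := GRing.Nmodule.on ghost.

End Ghost.

Section GhostMap.
Variables (k : fieldType) (W X : conn_log_scheme k) (f : conn_mor W X).

Definition ghost_map (x : ghost X) : ghost W :=
  cong_pi (ghost_cong W) (cmor_mon f (repr x)).

Lemma ghost_mapE (m : cmon X) :
  ghost_map (cong_pi (ghost_cong X) m) = cong_pi (ghost_cong W) (cmor_mon f m).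
Proof.
apply/cong_piP; have [s us e] := cong_reprP (ghost_cong X) m.
exists (cmor_mon f s); last by rewrite -raddfD e.
by rewrite cmor_alpha rmorph_unit.
Qed.

Lemma ghost_map_is_additive : nmod_morphism ghost_map.
Proof.
split=> [|x y]; first by rewrite ghost_mapE raddf0.
rewrite -[x]cong_piK -[y]cong_piK -raddfD !ghost_mapE raddfD.
exact: raddfD.
Qed.

HB.instance Definition _ :=
  GRing.isNmodMorphism.Build (ghost X) (ghost W) ghost_map ghost_map_is_additive.

End GhostMap.

Section UnitGroup.
Variable k : fieldType.

(* The multiplicative group of [k], written additively. *)
Record unit_group := UnitGroup { ug_val :> k; ug_neq0 : ug_val != 0 }.
HB.instance Definition _ := [isSub for ug_val].
HB.instance Definition _ := [Choice of unit_group by <:].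

Definition ug_zero := UnitGroup (oner_neq0 k).
Definition ug_add (x y : unit_group) := UnitGroup (mulf_neq0 (ug_neq0 x) (ug_neq0 y)).
Lemma ug_opp_subproof (x : unit_group) : (x : k)^-1 != 0.
Proof. by rewrite invr_neq0 // ug_neq0. Qed.
Definition ug_opp (x : unit_group) := UnitGroup (ug_opp_subproof x).

Lemma ug_addA : associative ug_add.
Proof. by move=> x y z; apply: val_inj; rewrite /= mulrA. Qed.
Lemma ug_addC : commutative ug_add.
Proof. by move=> x y; apply: val_inj; rewrite /= mulrC. Qed.
Lemma ug_add0 : left_id ug_zero ug_add.
Proof. by move=> x; apply: val_inj; rewrite /= mul1r. Qed.
Lemma ug_addN : left_inverse ug_zero ug_opp ug_add.
Proof. by move=> x; apply: val_inj; rewrite /= mulVf // ug_neq0. Qed.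

HB.instance Definition _ := GRing.isZmodule.Build unit_group
  ug_addA ug_addC ug_add0 ug_addN.

End UnitGroup.

Record sharp_fs_monoid := SharpFsMonoid {
  sfm_sort :> nmodType;
  sfm_fs : fs_monoid sfm_sort;
  sfm_sharp : sharp_monoid sfm_sort
}.

Section LogPoint.
Variables (k : fieldType) (Q : sharp_fs_monoid).

(* The log structure associated to [Q -> k] mapping [0] to [1] and [q <> 0]
   to [0]. *)
Definition log_point_alpha (x : Q * unit_group k) : k^o :=
  if x.1 == 0 then ug_val x.2 else 0.

Lemma log_point_unit x : (log_point_alpha x \is a GRing.unit) = (x.1 == 0).
Proof.
rewrite unitfE /log_point_alpha; case: (x.1 =P 0) => _; first exact: ug_neq0.
by rewrite eqxx.
Qed.

Lemma log_point_finite : finite_dim k^o.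
Proof.
exists 1%N, (fun=> 1) => a; exists (fun=> a).
by rewrite big_ord1 /GRing.scale /= mulr1.
Qed.

Lemma log_point_local : local_ring k^o.
Proof.
move=> a b; rewrite !unitfE; case: (eqVneq a 0) => // ->.
by rewrite add0r.
Qed.

Lemma log_point_log_structure : log_structure log_point_alpha.
Proof.
split=> [|[q u] [r v]|a]; first by rewrite /log_point_alpha eqxx.
  rewrite /log_point_alpha /=; have [->|q0] := eqVneq q 0.
    by rewrite add0r; case: eqP => //; rewrite mulr0.
  rewrite mul0r; case: eqP => // /(@sfm_sharp Q) q_eq0.
  by rewrite q_eq0 eqxx in q0.
rewrite unitfE => a0; exists (0, @UnitGroup k a a0); split.
  by rewrite /log_point_alpha eqxx.
case=> q u; rewrite /log_point_alpha /=; case: eqP => [-> e|_ e].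
  by congr pair; apply: val_inj; rewrite /= e.
by case/eqP: a0; rewrite e.
Qed.

Definition log_point_chart (q : Q) : Q * unit_group k := (q, 0).

Lemma log_point_chart_is_additive : nmod_morphism log_point_chart.
Proof.
split=> // x y; rewrite /log_point_chart; congr pair.
by rewrite addr0.
Qed.

HB.instance Definition _ := GRing.isNmodMorphism.Build Q (Q * unit_group k)%type
  log_point_chart log_point_chart_is_additive.

Lemma log_point_fs : fs_log_structure log_point_alpha.
Proof.
split; first exact: log_point_log_structure.
exists Q, log_point_chart; split; first exact: sfm_fs.
split=> [[q u]|l l' [q u] [q' u']].
  exists q, (0, u); rewrite log_point_unit eqxx; split=> //.
  by rewrite /log_point_chart; congr pair; rewrite ?addr0 ?add0r.
rewrite !log_point_unit /= => /eqP-> /eqP-> [].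
rewrite !addr0 => ll' uu'; exists 0, 0; rewrite !log_point_unit !eqxx.
split; rewrite ?addr0 //; congr pair; apply: val_inj.
by move: uu'; rewrite !mul1r => uu'; rewrite /= uu'.
Qed.

Definition log_point : conn_log_scheme k :=
  ConnLogScheme log_point_finite log_point_local log_point_fs.

End LogPoint.

Definition is_log_point (k : fieldType) (W : conn_log_scheme k) : Prop :=
  exists Q : sharp_fs_monoid, conn_iso W (log_point k Q).

(* An fs log scheme of finite length over [k] is the disjoint union of its
   connected components, which are its points. *)
Record log_scheme (k : fieldType) := LogScheme {
  points : finType;
  germ : points -> conn_log_scheme k
}.

Arguments germ {k} S s : rename.

Section LogMor.
Variable k : fieldType.
Implicit Types S T U : log_scheme k.

Record log_mor S T := LogMor {
  mor_points : points S -> points T;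
  mor_germ : forall s, conn_mor (germ S s) (germ T (mor_points s))
}.

Definition log_comp S T U (g : log_mor T U) (f : log_mor S T) : log_mor S U :=
  @LogMor S U (fun s => mor_points g (mor_points f s))
    (fun s => conn_comp (mor_germ g (mor_points f s)) (mor_germ f s)).

Definition log_of_conn (W : conn_log_scheme k) : log_scheme k :=
  @LogScheme k unit (fun=> W).

Definition log_mor_of_conn (W X : conn_log_scheme k) (f : conn_mor W X) :
    log_mor (log_of_conn W) (log_of_conn X) :=
  @LogMor (log_of_conn W) (log_of_conn X) id (fun=> f).

Definition nonempty_scheme S : Prop := inhabited (points S).

(* Finite length fs log schemes being closed under fs fibre products
   (integralisation is a closed immersion and saturation is finite),
   the fs fibre product of finite length fs log schemes is also their fibre
   product in this category. *)
Definition is_fs_fibre_product S1 S2 T F (f1 : log_mor S1 T) (f2 : log_mor S2 T)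
    (p1 : log_mor F S1) (p2 : log_mor F S2) : Prop :=
  log_comp f1 p1 = log_comp f2 p2 /\
  forall U (q1 : log_mor U S1) (q2 : log_mor U S2),
    log_comp f1 q1 = log_comp f2 q2 ->
    exists! u : log_mor U F, log_comp p1 u = q1 /\ log_comp p2 u = q2.

End LogMor.

Coercion log_of_conn : conn_log_scheme >-> log_scheme.
Coercion log_mor_of_conn : conn_mor >-> log_mor.

(* Main.v *)
Require Import Defs.
From HB Require Import structures.
From mathcomp Require Import all_boot all_order all_algebra.
From mathcomp Require Import all_classical all_reals all_analysis.
Set Implicit Arguments.
Unset Strict Implicit.
Unset Printing Implicit Defensive.
Import Order.TTheory GRing.Theory Num.Theory.
Import numFieldNormedType.Exports.
Local Open Scope classical_set_scope.
Local Open Scope ring_scope.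

(** By the universal property it suffices to map the standard log point
    Spec(N -> kappa) compatibly to W_1 and W_2.  A map from Spec(Q -> kappa) to W
    amounts to a local homomorphism from the ghost monoid of W to Q together with
    a character of M_W^gp, with values in kappa^*, extending the residue map on
    units.  Adding up two elements of the dual fibre product provided by (2) gives
    local homomorphisms Q_i -> N that agree on P.  For the characters, a point of
    W_1' x_X' W_2' gives compatible characters of M_{W_i'}^gp; by (3) the
    prescriptions "residue on units, the given character on M_{W_i'}^gp, trivial on
    the antidiagonal image of M_X^gp" are consistent on the subgroup they span in
    M_{W_1}^gp + M_{W_2}^gp, and the resulting character extends to the whole group
    because kappa^* is divisible. *)

(** * Homomorphisms into divisible groups *)

Definition divisible (D : zmodType) : Prop :=
  forall (d : D) (n : nat), (0 < n)%N -> exists e, e *+ n = d.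

(** A homomorphism to [D] from a subgroup of [B], encoded by its graph. Extension is then inclusion
    of sets, as needed for Zorn's lemma. *)
Record partial_hom (B D : zmodType) (G : set (B * D)) : Prop := PartialHom {
  partial_hom0 : G 0;
  partial_homB : forall x y, G x -> G y -> G (x - y);
  partial_hom_fun : forall d, G (0, d) -> d = 0
}.

Section PartialHom.
Variables (B D : zmodType) (G : set (B * D)).
Hypothesis G_hom : partial_hom G.

Lemma partial_homN x : G x -> G (- x).
Proof.
by move=> Gx; rewrite -sub0r; apply: partial_homB => //; apply: partial_hom0.
Qed.

Lemma partial_homD x y : G x -> G y -> G (x + y).
Proof. by move=> Gx /partial_homN Gy; rewrite -[y]opprK; apply: partial_homB. Qed.

Lemma partial_homMn x n : G x -> G (x *+ n).
Proof.
move=> Gx; elim: n => [|n IHn]; first by rewrite mulr0n; apply: partial_hom0.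
by rewrite mulrSr; apply: partial_homD.
Qed.

Lemma partial_homMz x k : G x -> G (x *~ k).
Proof.
by case: k => n Gx; [|rewrite NegzE mulrNz; apply: partial_homN];
  apply: partial_homMn.
Qed.

Lemma partial_hom_inj b d e : G (b, d) -> G (b, e) -> d = e.
Proof.
move=> Gd Ge; apply/eqP; rewrite -subr_eq0; apply/eqP.
apply: (partial_hom_fun G_hom); rewrite -(subrr b).
exact: (partial_homB G_hom Gd Ge).
Qed.

Definition adjoin (b : B) (d : D) : set (B * D) :=
  [set z | exists k x, G x /\ z = x + (b, d) *~ k].

Lemma pairMz (b : B) (d : D) k : (b, d) *~ k = (b *~ k, d *~ k).
Proof.
have pairMn n : (b, d) *+ n = (b *+ n, d *+ n).
  by elim: n => // n IHn; rewrite !mulrSr IHn.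
by case: k => n; rewrite ?NegzE ?mulrNz -?pmulrn pairMn.
Qed.

(** The integers [k] with [b *~ k] in the domain of [G] form a subgroup of the integers. If it has a
    least positive element [n], the value at [b] must be an [n]-th part of the value at [b *+ n],
    which exists by divisibility; otherwise any value will do. *)
Lemma adjoin_hom (b : B) : divisible D ->
  exists d, partial_hom (adjoin b d).
Proof.
move=> divD.
(* Only single-valuedness at 0 needs work: an element of the domain of [G] that cancels [b *~ k]
   must have value [- d *~ k]. *)
suff [d fund] : exists d, forall k e, G (- b *~ k, e) -> e + d *~ k = 0.
  exists d; split.
  - by exists 0, 0; split; rewrite ?mulr0z ?addr0 //; apply: partial_hom0.
  - move=> _ _ [k [x [Gx ->]]] [l [y [Gy ->]]]; exists (k - l), (x - y).
    split; first exact: partial_homB.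
    by rewrite mulrzBr opprD addrACA.
  - move=> e [k [[x1 x2] [Gx]]]; rewrite pairMz => -[x1E ->]; apply: fund.
    by rewrite mulNrz; move/esym/eqP: x1E; rewrite addr_eq0 => /eqP <-.
pose P n := (0 < n)%N && `[< exists e, G (b *+ n, e) >].
have [exP|noP] := pselect (exists n, P n); last first.
  exists 0 => k e Gke; rewrite mul0rz addr0.
  have [k0|k0] := eqVneq k 0.
    by move: Gke; rewrite k0 mulr0z; apply: partial_hom_fun.
  exfalso; apply: noP; exists (absz k); rewrite /P absz_gt0 k0; apply/asboolP.
  case: k Gke {k0} => n; rewrite ?NegzE ?mulrNz ?mulNrz ?opprK; last by exists e.
  by move=> /partial_homN Gn; exists (- e); rewrite -[b *+ _]opprK.
case: (ex_minnP exP) => n /andP[n_gt0 /asboolP[c Gc]] n_min.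
have [d dn] := divD c n n_gt0.
exists d => k e Gke.
have kE := divz_eq k n.
have n_neq0 : n%:Z != 0 by rewrite eqz_nat -lt0n.
have r_ge0 := modz_ge0 k n_neq0.
have r_lt : (modz k n < n)%R by apply: ltz_pmod.
(* Euclidean division: the remainder multiple of [b] is in the domain too, so minimality of [n]
   makes the remainder 0, and then its value is 0. *)
have Gr : G (b *~ modz k n, - e - c *~ divz k n).
  have -> : (b *~ modz k n, - e - c *~ divz k n) =
    - (- b *~ k, e) - (b *+ n, c) *~ divz k n.
    have bk : b *~ k = b *+ n *~ divz k n + b *~ modz k n.
      by rewrite {1}kE mulrzDr mulrC mulrzA.
    by rewrite pairMz; congr pair => /=; rewrite mulNrz opprK bk addrC addKr.
  by apply: partial_homB => //; [apply: partial_homN | apply: partial_homMz].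
have r0 : modz k n = 0.
  apply/eqP; apply: contraTT r_lt => r_neq0; rewrite -real_leNgt ?num_real //.
  move: r_ge0 r_neq0 Gr; case: (modz k n) => // r _ r_neq0 Gr.
  rewrite lez_nat; apply: n_min; rewrite /P lt0n r_neq0.
  by apply/asboolP; exists (- e - c *~ divz k n).
move: Gr; rewrite r0 mulr0z => /(partial_hom_fun G_hom)/eqP.
rewrite subr_eq0 => /eqP eE; rewrite kE r0 addr0 mulrC mulrzA -pmulrn dn -eE.
exact: subrr.
Qed.
End PartialHom.

(** Divisible groups are injective: a maximal extension of [G] is defined everywhere, since
    otherwise [adjoin_hom] enlarges it. *)
Lemma extend_partial_hom (B D : zmodType) (G : set (B * D)) :
  divisible D -> partial_hom G ->
  exists chi : {additive B -> D}, forall b d, G (b, d) -> chi b = d.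
Proof.
move=> divD G_hom.
pose P (H : set (B * D)) := H = set0 \/ (partial_hom H /\ G `<=` H).
have [F FP Ftot|H [HP Hmax]] := @Zorn_bigcup (B * D)%type P.
  have [[H0 [FH0 H0n]]|Fe] := pselect (exists H, F H /\ H <> set0); last first.
    left; apply/seteqP; split => // x [H FH Hx]; apply: Fe; exists H; split=> //.
    by move=> He; rewrite He in Hx.
  have [//|[H0h GH0]] := FP _ FH0.
  have Fh H : F H -> H <> set0 -> partial_hom H.
    by move=> FH Hn; have [//|[]] := FP _ FH.
  have n0 (H : set (B * D)) x : H x -> H <> set0.
    by move=> Hx He; rewrite He in Hx.
  right; split; last by move=> x /GH0 ?; exists H0.
  split; first by exists H0 => //; apply: partial_hom0.
    move=> x y [H FH Hx] [H' FH' Hy].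
    have [HH'|H'H] := Ftot _ _ FH FH'.
      exists H' => //.
      exact: (partial_homB (Fh _ FH' (n0 _ _ Hy)) (HH' _ Hx) Hy).
    exists H => //.
    exact: (partial_homB (Fh _ FH (n0 _ _ Hx)) Hx (H'H _ Hy)).
  move=> d [H FH Hd]; apply: (@partial_hom_fun _ _ H) => //.
  exact: Fh (n0 _ _ Hd).
have [H0|[H_hom GH]] := HP.
  exfalso; apply: (Hmax G); last by right; split.
  rewrite H0; split; first exact: sub0set.
  by move=> /(_ 0) G0; apply: G0 (partial_hom0 G_hom).
have tot b : exists d, H (b, d).
  have [d ad] := adjoin_hom H_hom b divD.
  exists d; apply: contrapT => nHd; apply: (Hmax (adjoin H b d)); last first.
    right; split=> // x /GH Hx; exists 0, x; split=> //.
    by rewrite mulr0z addr0.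
  split; first by move=> x Hx; exists 0, x; rewrite mulr0z addr0.
  move=> /(_ (b, d)) aH; apply: nHd; apply: aH; exists 1, 0.
  by split; rewrite ?add0r //; apply: partial_hom0.
pose chi b := projT1 (cid (tot b)).
have chiP b : H (b, chi b) by rewrite /chi; case: cid.
have chi_zmod : zmod_morphism chi.
  move=> x y; apply: (@partial_hom_inj _ _ _ H_hom (x - y)); first exact: chiP.
  exact: (partial_homB H_hom (chiP x) (chiP y)).
pose m := GRing.isZmodMorphism.Build _ _ chi chi_zmod.
exists (HB.pack_for {additive B -> D} chi m) => b d /GH Hd.
exact: (partial_hom_inj H_hom (chiP b) Hd).
Qed.

(** * Residue maps *)

Section Residue.
Variables (k : closedFieldType) (W : conn_log_scheme k).
Local Notation A := (cring W).

(** The powers of [a] from 0 to [n] are [n.+1] combinations of [n] generators, so their coefficient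
    matrix has a nonzero left kernel vector. *)
Lemma annihilating_poly (a : A) :
  exists2 p : {poly k}, p != 0 & horner_alg a p = 0.
Proof.
have [n [b bgen]] := cring_finite W.
pose c (i : 'I_n.+1) := projT1 (cid (bgen (a ^+ i))).
have cP (i : 'I_n.+1) : a ^+ i = \sum_(j < n) c i j *: b j.
  by rewrite /c; case: cid.
pose C := \matrix_(i < n.+1, j < n) c i j.
have ker_neq0 : kermx C != 0.
  by rewrite kermx_eq0 /row_free neq_ltn ltnS rank_leq_col.
have /rowV0Pn[v /sub_kermxP vC v_neq0] := ker_neq0.
exists (\poly_(i < n.+1) v 0 (inord i)).
  apply: contra_neq v_neq0 => p0; apply/rowP => i.
  have := congr1 (fun p : {poly k} => p`_i) p0.
  by rewrite coef_poly ltn_ord inord_val coef0 mxE.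
rewrite poly_def raddf_sum /=.
have -> : \sum_(i < n.+1) horner_alg a (v 0 (inord i) *: 'X^i) =
    \sum_(i < n.+1) v 0 i *: a ^+ i.
  apply: eq_bigr => i _.
  by rewrite linearZ /= rmorphXn /= horner_algX inord_val mulr_algl.
under eq_bigr => i _ do rewrite cP scaler_sumr.
rewrite exchange_big big1 //= => j _.
under eq_bigr => i _ do rewrite scalerA.
rewrite -scaler_suml; have := congr1 (fun M : 'rV_n => M 0 j) vC.
rewrite !mxE; under eq_bigr => i _ do rewrite mxE.
by move=> ->; rewrite scale0r.
Qed.

Lemma nonunitD (a b : A) :
  a \isn't a GRing.unit -> b \isn't a GRing.unit -> a + b \isn't a GRing.unit.
Proof. by move=> /negPf ua /negPf ub; apply/negP => /cring_local; rewrite ua ub. Qed.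

Lemma nonunitM (a b : A) : a \isn't a GRing.unit -> a * b \isn't a GRing.unit.
Proof. by move=> /negPf ua; rewrite unitrM ua. Qed.

Lemma unit_alg (c : k) : (c%:A : A) \is a GRing.unit = (c != 0).
Proof.
apply/idP/idP => [|c0]; last by rewrite scaler_unit ?unitfE ?unitr1.
by apply: contraTneq => ->; rewrite scale0r unitr0.
Qed.

(** An annihilating polynomial splits into linear factors, whose product evaluated at [a] is 0;
    hence some [a - z%:A] is not a unit. *)
Lemma residue_exists (a : A) : exists c : k, a - c%:A \isn't a GRing.unit.
Proof.
have [p p0 pa] := annihilating_poly a.
have [r pE] := closed_field_poly_normal p.
have : horner_alg a (\prod_(z <- r) ('X - z%:P)) \isn't a GRing.unit.
  move: pa; rewrite pE linearZ /= mulr_algl => /(congr1 ( *:%R (lead_coef p)^-1)).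
  rewrite scalerA mulVf ?lead_coef_eq0 // scale1r scaler0 => ->.
  by rewrite unitr0.
rewrite rmorph_prod /=; elim: r {pE} => [|z r IHr].
  by rewrite big_nil unitr1.
rewrite big_cons unitrM negb_and => /orP[|//].
by rewrite rmorphB /= horner_algX horner_algC; exists z.
Qed.

Definition residue (a : A) : k^o := projT1 (cid (residue_exists a)).

Lemma residueP a : a - (residue a)%:A \isn't a GRing.unit.
Proof. by rewrite /residue; case: cid. Qed.

(** Two distinct candidates would make a nonzero constant a sum of two nonunits, impossible in a
    local ring. *)
Lemma residue_eq a c : a - c%:A \isn't a GRing.unit -> residue a = c.
Proof.
move=> ac; apply: contraNeq (nonunitD ac (nonunitM (- 1) (residueP a))) => rc.
by rewrite mulrN1 opprB addrC addrA subrK -scalerBl unit_alg subr_eq0.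
Qed.

Lemma residue_linear : linear residue.
Proof.
move=> c a b; apply: residue_eq; rewrite scalerDl -scalerA opprD addrACA -scalerBr.
apply: nonunitD; last exact: residueP.
by rewrite -[a - _]mulr1 scalerAr; apply: nonunitM (residueP a).
Qed.

Lemma residue_monoid : monoid_morphism residue.
Proof.
split=> [|a b]; apply: residue_eq; first by rewrite scale1r subrr unitr0.
have -> : a * b - (residue a * residue b)%:A =
    (a - (residue a)%:A) * b + (b - (residue b)%:A) * (residue a)%:A.
  rewrite !mulrBl [b * _]mulrC addrA subrK; congr (_ - _).
  by rewrite mulr_algl scalerA mulrC.
by apply: nonunitD; apply: nonunitM; apply: residueP.
Qed.

HB.instance Definition _ := GRing.isLinear.Build k A k^o *:%R
  residue residue_linear.
HB.instance Definition _ := GRing.isMonoidMorphism.Build A k^o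
  residue residue_monoid.

Lemma residue_eq0 a : (residue a == 0) = (a \isn't a GRing.unit).
Proof.
apply/eqP/idP => [a0|ua]; first by have := residueP a; rewrite a0 scale0r subr0.
by apply: residue_eq; rewrite scale0r subr0.
Qed.

(** [rho] kills [a - (rho a)%:A], which is therefore not a unit. *)
Lemma residue_unique (rho : {lrmorphism A -> k^o}) : rho =1 residue.
Proof.
move=> a; apply/esym/residue_eq; apply: contraTN isT => /(rmorph_unit rho).
by rewrite rmorphB /= linearZ /= rmorph1 /GRing.scale /= mulr1 subrr unitr0.
Qed.

End Residue.

(** * Ghost monoids and characters *)

Section GroupCompletionTheory.
Implicit Types M N L : nmodType.

Lemma gpE M (x : gp M) : exists a b, x = to_gp a - to_gp b.
Proof.
have [a [b ->]] := gp_pair x; exists a, b; apply/eqP.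
rewrite eq_sym subr_eq -raddfD; apply/eqP/cong_piP.
by exists 0; rewrite /= !addr0 addrC.
Qed.

Lemma to_gp_inj M : integral_monoid M -> injective (@to_gp M).
Proof. by move=> intM a b /cong_piP[k] /=; rewrite !addr0 => /intM. Qed.

Lemma gp_map_to_gp M N (f : {additive M -> N}) m :
  gp_map f (to_gp m) = to_gp (f m).
Proof. by rewrite gp_mapE raddf0. Qed.

Lemma gp_map_square M N N' L (f : {additive M -> N}) (h : {additive N -> L})
    (f' : {additive M -> N'}) (h' : {additive N' -> L}) :
  (forall m, h (f m) = h' (f' m)) ->
  forall x, gp_map h (gp_map f x) = gp_map h' (gp_map f' x).
Proof.
by move=> e x; have [a [b ->]] := gpE x; rewrite !raddfB /= !gp_map_to_gp !e.
Qed.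

Lemma gp_map_inj M N (f : {additive M -> N}) :
  integral_monoid N -> injective f -> injective (gp_map f).
Proof.
move=> intN f_inj; apply: raddf_inj => x; have [a [b ->]] := gpE x.
rewrite raddfB /= !gp_map_to_gp => /subr0_eq/(to_gp_inj intN)/f_inj ->.
exact: subrr.
Qed.

End GroupCompletionTheory.

Section GhostTheory.
Variables (k : fieldType) (W : conn_log_scheme k).
Let ls : log_structure (calpha W) := (calpha_fs W).1.

Lemma unit_opp (s : cmon W) : calpha W s \is a GRing.unit ->
  exists2 t, calpha W t \is a GRing.unit & s + t = 0.
Proof.
move=> us; have [|t ut t0] := @ghost_rel_sym _ W 0 s; last by exists t.
by exists s => //; rewrite add0r.
Qed.

Lemma unit_addI (s x y : cmon W) :
  calpha W s \is a GRing.unit -> x + s = y + s -> x = y.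
Proof.
move=> /unit_opp[t _ st] /(congr1 (fun z => z + t)).
by rewrite -!addrA st !addr0.
Qed.

Lemma unitD (s t : cmon W) :
  calpha W (s + t) \is a GRing.unit =
  (calpha W s \is a GRing.unit) && (calpha W t \is a GRing.unit).
Proof. by rewrite (log_alphaD ls) unitrM. Qed.

(** Integrality is inherited from the chart monoid [L]: elements are written as chart elements plus
    units, [chart_inj] turns the equality into one in [L] and one between units, and the common
    terms cancel in each. *)
Lemma integral_cmon : integral_monoid (cmon W).
Proof.
have [_ [L [beta [[intL _ _] [surj inj]]]]] := calpha_fs W.
move=> z x y; have [l [s [us ->]]] := surj x; have [l' [s' [us' ->]]] := surj y.
have [n [t [ut ->]]] := surj z; rewrite [LHS]addrACA [RHS]addrACA -!raddfD => e.
have ust : calpha W (s + t) \is a GRing.unit by rewrite unitD us.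
have ust' : calpha W (s' + t) \is a GRing.unit by rewrite unitD us'.
have [a [b [ua ub lE sE]]] := inj _ _ _ _ ust ust' e.
have lab : l + a = l' + b.
  by apply: (intL n); rewrite addrAC lE addrAC.
have sba : s + beta b = s' + beta a.
  by apply: (unit_addI ut); rewrite addrAC sE addrAC.
(* Adding the invertible elements [beta a] and [beta b] to both sides makes [sba] and [lab]
   applicable. *)
apply: (unit_addI ua); apply: (unit_addI ub).
rewrite -[LHS]addrA -[RHS]addrA [beta a + _]addrC.
rewrite [LHS](AC (2*2) ((1*4)*(2*3))) [RHS](AC (2*2) ((1*3)*(2*4))) /=.
by rewrite sba -!raddfD lab.
Qed.

Definition ghost_pi : cmon W -> ghost W := cong_pi (ghost_cong W).

HB.instance Definition _ := GRing.isNmodMorphism.Build _ _ ghost_pi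
  (cong_pi_is_additive (ghost_cong W)).

Lemma ghost_piP m n :
  ghost_pi m = ghost_pi n <->
  exists2 s, calpha W s \is a GRing.unit & m + s = n.
Proof. exact: (cong_piP (ghost_cong W)). Qed.

Lemma ghost_pi_surj x : exists m, x = ghost_pi m.
Proof. by exists (repr x); rewrite /ghost_pi cong_piK. Qed.

Lemma ghost_pi_eq0 m : ghost_pi m = 0 <-> calpha W m \is a GRing.unit.
Proof.
split=> [/esym|um].
  by rewrite -[0](raddf0 ghost_pi) => /ghost_piP[s us <-]; rewrite add0r.
apply/esym; rewrite -[0](raddf0 ghost_pi); apply/ghost_piP.
by exists m; rewrite ?add0r.
Qed.

Lemma integral_ghost : integral_monoid (ghost W).
Proof.
move=> z x y; have [l ->] := ghost_pi_surj x; have [m ->] := ghost_pi_surj y.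
have [n ->] := ghost_pi_surj z; rewrite -!raddfD => /ghost_piP[s us].
by rewrite addrAC => /integral_cmon e; apply/ghost_piP; exists s.
Qed.

Lemma sharp_ghost : sharp_monoid (ghost W).
Proof.
move=> x y; have [m ->] := ghost_pi_surj x; have [n ->] := ghost_pi_surj y.
rewrite -raddfD => /ghost_pi_eq0; rewrite unitD => /andP[um _].
exact/ghost_pi_eq0.
Qed.

Lemma gp_ghost_pi_surj x : exists m, x = gp_map ghost_pi m.
Proof.
have [a [b ->]] := gpE x; have [m ->] := ghost_pi_surj a.
have [n ->] := ghost_pi_surj b; exists (to_gp m - to_gp n).
by rewrite raddfB /= !gp_map_to_gp.
Qed.

(** By integrality of the ghost monoid, if the class of a difference vanishes, its two terms have
    equal ghosts and so differ by a unit. *)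
Lemma gp_ghost_pi_eq0 x : gp_map ghost_pi x = 0 ->
  exists2 s, calpha W s \is a GRing.unit & x = to_gp s.
Proof.
have [a [b ->]] := gpE x; rewrite raddfB /= !gp_map_to_gp.
move=> /subr0_eq/esym/(to_gp_inj integral_ghost)/ghost_piP[s us <-].
by exists s; rewrite // raddfD addrC addKr.
Qed.

End GhostTheory.

Lemma ghost_map_pi (k : fieldType) (W X : conn_log_scheme k)
    (f : conn_mor W X) m :
  ghost_map f (ghost_pi m) = ghost_pi (cmor_mon f m).
Proof. exact: ghost_mapE. Qed.

Lemma gp_ghost_map_pi (k : fieldType) (W X : conn_log_scheme k)
    (f : conn_mor W X) x :
  gp_map (ghost_map f) (gp_map (@ghost_pi _ X) x) =
  gp_map (@ghost_pi _ W) (gp_map (cmor_mon f) x).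
Proof. by apply: gp_map_square => m; apply: ghost_map_pi. Qed.

Lemma cmor_unit (k : fieldType) (W X : conn_log_scheme k)
    (f : conn_mor W X) m :
  calpha X m \is a GRing.unit -> calpha W (cmor_mon f m) \is a GRing.unit.
Proof. by move=> um; rewrite cmor_alpha rmorph_unit. Qed.

Section Characters.
Variable k : closedFieldType.
Implicit Types W X : conn_log_scheme k.

Lemma residue_cmor W X (f : conn_mor W X) a :
  @residue _ W (cmor_ring f a) = @residue _ X a.
Proof. exact: (residue_unique (@residue _ W \o cmor_ring f)). Qed.

(** In additive notation, dividing by [n] means extracting an [n]-th root. *)
Lemma unit_group_divisible : divisible (unit_group k).
Proof.
move=> d n n_gt0; pose p : {poly k} := 'X^n - (ug_val d)%:P.
have /closed_rootP[z] : size p != 1.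
  by rewrite size_XnsubC // eqSS -lt0n.
rewrite /root !hornerE subr_eq0 => /eqP zn.
have z0 : z != 0.
  by apply: contra_eq_neq zn => ->; rewrite expr0n gtn_eqF //= eq_sym ug_neq0.
exists (UnitGroup z0); apply: val_inj; rewrite /= -zn.
by elim: n {n_gt0 p zn} => // n IHn; rewrite mulrS exprS /= IHn.
Qed.

(* The [unit_group k] component of a map from a log point to [W]. *)
Definition residue_char W (chi : gp (cmon W) -> unit_group k) : Prop :=
  forall s, calpha W s \is a GRing.unit ->
    ug_val (chi (to_gp s)) = @residue _ W (calpha W s).

(** By integrality the units embed in the group completion; on their image the residue is a
    well-defined character, which extends by divisibility. *)
Lemma residue_char_exists W :
  exists chi : {additive gp (cmon W) -> unit_group k}, residue_char chi.
Proof.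
have ls := (calpha_fs W).1.
pose G : set (gp (cmon W) * unit_group k) := [set z | exists2 s,
  calpha W s \is a GRing.unit &
  z.1 = to_gp s /\ ug_val z.2 = @residue _ W (calpha W s)].
have G_hom : partial_hom G.
  split.
  - exists 0; first by rewrite (log_alpha0 ls) unitr1.
    by rewrite (log_alpha0 ls) rmorph1 raddf0.
  - move=> [x1 x2] [y1 y2] [s us /= [-> x2E]] [t ut /= [-> y2E]].
    have [t' ut' tt'] := unit_opp ut; exists (s + t'); first by rewrite unitD us.
    split=> /=.
      apply/eqP; rewrite subr_eq -raddfD -addrA [t' + t]addrC tt' addr0.
      by apply/eqP.
    rewrite (log_alphaD ls) rmorphM /= x2E; congr (_ * _).
    rewrite y2E; apply: (mulfI (_ : @residue _ W (calpha W t) != 0)).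
      by rewrite residue_eq0 negbK.
    rewrite divff ?residue_eq0 ?negbK // -rmorphM -(log_alphaD ls) tt'.
    by rewrite (log_alpha0 ls) rmorph1.
  - move=> d [s us /= [/esym s0 dE]]; apply: val_inj; rewrite /= dE.
    rewrite -[0](raddf0 (@to_gp _)) in s0.
    by rewrite (to_gp_inj (@integral_cmon _ W) s0) (log_alpha0 ls) rmorph1.
have [chi chiP] := extend_partial_hom unit_group_divisible G_hom.
exists chi => s us.
have rs : @residue _ W (calpha W s) != 0 by rewrite residue_eq0 negbK.
by rewrite (chiP _ (UnitGroup rs)) //; exists s.
Qed.

Lemma residue_char_comp W X (f : conn_mor W X)
    (chi : gp (cmon W) -> unit_group k) :
  residue_char chi -> residue_char (chi \o gp_map (cmor_mon f)).
Proof.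
move=> chiP s us; rewrite /= gp_map_to_gp chiP ?cmor_unit //.
by rewrite cmor_alpha residue_cmor.
Qed.

Lemma residue_char_eq W (chi psi : gp (cmon W) -> unit_group k) s :
  residue_char chi -> residue_char psi -> calpha W s \is a GRing.unit ->
  chi (to_gp s) = psi (to_gp s).
Proof. by move=> chiP psiP us; apply: val_inj; rewrite /= chiP // psiP. Qed.

End Characters.

(** * Interior of the dual cone *)

(** Integrality and sharpness give [q] infinite order in [gp Q], so sending [q] to 1 defines a
    homomorphism on the subgroup it generates, which extends because [R] is divisible. *)
Lemma real_hom_neq0 (R : realType) (Q : nmodType) (q : Q) :
  integral_monoid Q -> sharp_monoid Q -> q <> 0 ->
  exists k : {additive Q -> R}, k q = 1.
Proof.
move=> intQ shQ q0.
have q_tors n : q *+ n = 0 -> n = 0%N.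
  by case: n => // n; rewrite mulrS => /shQ.
pose G : set (gp Q * R) := [set z | exists k : int, z = (to_gp q *~ k, k%:~R)].
have divR : divisible R.
  move=> d n n0; exists (d / n%:R).
  by rewrite -[LHS]mulr_natr mulfVK // pnatr_eq0 -lt0n.
have G_hom : partial_hom G.
  split; first by exists 0.
    move=> _ _ [k ->] [l ->]; exists (k - l).
    by rewrite mulrzBr intrB.
  move=> d [k [qk ->]]; suff -> : k = 0 by [].
  have toq n : to_gp q *+ n = 0 -> n = 0%N.
    move=> qn; apply/q_tors/(to_gp_inj intQ).
    by rewrite raddf0 raddfMn.
  case: k qk => n /esym; first by move/toq ->.
  by rewrite NegzE mulrNz => /eqP; rewrite oppr_eq0 => /eqP/toq.
have [k kP] := extend_partial_hom divR G_hom.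
exists (k \o @to_gp Q); apply: kP; exists 1; by rewrite mulr1z.
Qed.

(* Moving [h] off the cone along a homomorphism [k] with [k q = 1]. *)
Lemma interior_dual_eq0 (R : realType) (Q : nmodType) (h : dual Q) (q : Q) :
  integral_monoid Q -> sharp_monoid Q -> interior_dual R h -> h q = 0 -> q = 0.
Proof.
move=> intQ shQ hint hq; apply: contrapT => q0.
have [k kq] := real_hom_neq0 R intQ shQ q0.
pose hR : Q -> R := fun x => (h x)%:R.
have hR_hom : @real_homs R Q hR.
  by split=> [|x y]; rewrite /hR ?raddf0 // raddfD natrD.
(* For [t > 0] this is a homomorphism with the negative value [- t] at [q], yet it tends to [hR] as
   [t] tends to 0. *)
pose path (t : R) : Q -> R := fun x => hR x - t * k x.
have path_cvg : {ptws, path @ (0 : R) --> hR}.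
  apply/cvg_sup => x; rewrite cvg_image; last first.
    by rewrite eqEsubset; split=> v // _; exists (cst v).
  suff path_x : (fun t => path t x) @ (0 : R) --> hR x.
    apply: cvg_trans path_x => Y /=; rewrite !nbhs_simpl /= => YE.
    exists [set g | Y (g x)] => //; rewrite eqEsubset.
    by split=> [_ [g Yg <-]|y Yy] //; exists (cst y).
  have -> : hR x = hR x - 0 * k x by rewrite mul0r subr0.
  apply: cvgB; first exact: cvg_cst.
  by apply: cvgM; [apply: cvg_id | apply: cvg_cst].
(* The interior is relative to the subspace of homomorphisms; it yields a neighbourhood for
   pointwise convergence whose homomorphisms lie in the cone. *)
have /path_cvg : nbhs (hR : {ptws Q -> R})
    [set x | @real_homs R Q x -> @dual_cone R Q x].
  move: hint; rewrite /interior_dual /= /interior /=.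
  by rewrite -[nbhs _](nbhs_subspace_in hR_hom).
move=> /nbhs_ballP[e e_gt0 e_cone].
have [||_ /(_ q)] := e_cone (e / 2).
- rewrite -ball_normE /= sub0r normrN gtr0_norm ?divr_gt0 //.
  by rewrite ltr_pdivrMr // ltr_pMr // ltr1n.
- split; first by rewrite /path /hR !raddf0 mulr0 subr0.
  by move=> x y; rewrite /path hR_hom.2 raddfD /= mulrDr opprD addrACA.
rewrite /path /hR hq kq mulr1 sub0r oppr_ge0 leNgt => /negP; apply.
exact: divr_gt0.
Qed.

(** * Extending compatible characters *)

Lemma coker_pi_eq0 (U V : zmodType) (f : {additive U -> V}) (v : V) :
  cong_pi (coker_cong f) v = 0 <-> exists u, v = f u.
Proof.
rewrite -[0](raddf0 (cong_pi (coker_cong f))).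
split=> [/cong_piP[u vu]|[u vu]]; first by exists u; rewrite -vu subr0.
by apply/cong_piP; exists u; rewrite subr0.
Qed.

(** As [coker_map] is a bare function, vanishing of an image is stated as agreement with the image
    of 0, ready for an injectivity hypothesis. *)
Lemma coker_map_eq (U V U' V' : zmodType) (f : {additive U -> V})
    (f' : {additive U' -> V'}) (h : V -> V') (c : U -> U') v u' :
  {morph h : x y / x - y} -> (forall u, h (f u) = f' (c u)) -> h v = f' u' ->
  coker_map f' h (cong_pi (coker_cong f) v) = coker_map f' h (0 : coker f).
Proof.
move=> hB hc hv; rewrite -[0](raddf0 (cong_pi (coker_cong f))) !(coker_mapE _ hB hc).
have -> : h 0 = 0 by rewrite -(subrr 0) hB subrr.
by rewrite raddf0; apply/coker_pi_eq0; exists u'.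
Qed.

Section CompatibleCharacters.
Variables (k : closedFieldType) (W1 W2 X W1' W2' X' : conn_log_scheme k).
Variables (f1 : conn_mor W1 X) (f2 : conn_mor W2 X).
Variables (f1' : conn_mor W1' X') (f2' : conn_mor W2' X').
Variables (g1 : conn_mor W1 W1') (g2 : conn_mor W2 W2') (g : conn_mor X X').

Local Notation gpm f := (gp_map (cmor_mon f)).
Local Notation pi W := (gp_map (@ghost_pi _ W)).

Lemma conn_square_gp (Y Y' : conn_log_scheme k) (f : conn_mor Y X)
    (f' : conn_mor Y' X') (h : conn_mor Y Y') :
  conn_comp g f = conn_comp f' h ->
  forall x, gpm f (gpm g x) = gpm h (gpm f' x).
Proof.
move=> gf; apply: gp_map_square => m.
exact: (congr1 (fun q => cmor_mon q m) gf).
Qed.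

Lemma conn_square_ghost (Y Y' : conn_log_scheme k) (f : conn_mor Y X)
    (f' : conn_mor Y' X') (h : conn_mor Y Y') :
  conn_comp g f = conn_comp f' h ->
  forall x, gp_map (ghost_map f) (gp_map (ghost_map g) x) =
            gp_map (ghost_map h) (gp_map (ghost_map f') x).
Proof.
move=> gf x; have [y ->] := gp_ghost_pi_surj x.
by rewrite !gp_ghost_map_pi (conn_square_gp gf).
Qed.

Hypothesis gf1 : conn_comp g f1 = conn_comp f1' g1.
Hypothesis gf2 : conn_comp g f2 = conn_comp f2' g2.
Hypothesis g1_inj : injective (ghost_map g1).
Hypothesis g2_inj : injective (ghost_map g2).
Hypothesis theta_inj : injective (fun x : coker (gp_map (ghost_map g)) =>
     (coker_map (gp_map (ghost_map g1)) (gp_map (ghost_map f1)) x,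
      coker_map (gp_map (ghost_map g2)) (fun y => - gp_map (ghost_map f2) y) x)).

(** Hypothesis (3) lifted from ghosts to log structures: if the images of [x] come, up to units,
    from [W1'] and [W2'], then [x] comes from [X'] up to units. *)
Lemma theta_lift (x : gp (cmon X)) (m1 : gp (cmon W1')) (m2 : gp (cmon W2')) :
  pi W1 (gpm f1 x) = pi W1 (gpm g1 m1) -> pi W2 (gpm f2 x) = pi W2 (gpm g2 m2) ->
  exists x', pi X (x - gpm g x') = 0.
Proof.
rewrite -!gp_ghost_map_pi => e1 e2.
have /coker_pi_eq0[u xu] : cong_pi (coker_cong (gp_map (ghost_map g))) (pi X x) = 0.
  apply: theta_inj; congr pair.
    apply: coker_map_eq (conn_square_ghost gf1) e1; exact: raddfB.
  (* The sign in the second component of theta is carried by both [c] and [u']. *)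
  apply: (coker_map_eq (c := fun u => - gp_map (ghost_map f2') u)
    (u' := - pi W2' m2)).
  - by move=> y z /=; rewrite raddfB opprB opprK addrC.
  - by move=> y; rewrite (conn_square_ghost gf2) raddfN.
  - by rewrite e2 raddfN.
have [x' u_x'] := gp_ghost_pi_surj u.
exists x'; rewrite raddfB /= xu u_x'; apply/eqP; rewrite subr_eq0; apply/eqP.
exact: gp_ghost_map_pi.
Qed.

Lemma residue_char_ker (W : conn_log_scheme k)
    (chi psi : {additive gp (cmon W) -> unit_group k}) y :
  residue_char chi -> residue_char psi -> pi W y = 0 -> chi y = psi y.
Proof.
move=> chiP psiP /gp_ghost_pi_eq0[s us ->]; exact: residue_char_eq.
Qed.

Lemma pi_gpm_eq0 (W Y : conn_log_scheme k) (f : conn_mor W Y) y :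
  pi Y y = 0 -> pi W (gpm f y) = 0.
Proof. by rewrite -gp_ghost_map_pi => ->; rewrite raddf0. Qed.

(** The relation makes [gpm h (m + gpm f' x')] a unit, so injectivity on ghosts makes
    [m + gpm f' x'] a unit of [W']. There [chi] agrees with the pullback of [psi], both being given
    by the residue. *)
Lemma char_relation (W W' : conn_log_scheme k) (f : conn_mor W X)
    (f' : conn_mor W' X') (h : conn_mor W W')
    (psi : {additive gp (cmon W) -> unit_group k})
    (chi : {additive gp (cmon W') -> unit_group k}) y m v x' :
  conn_comp g f = conn_comp f' h -> injective (ghost_map h) ->
  residue_char psi -> residue_char chi -> pi W y = 0 -> pi X v = 0 ->
  y + gpm h m + gpm f (v + gpm g x') = 0 ->
  psi y + chi m = - (psi (gpm f v) + chi (gpm f' x')).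
Proof.
move=> gf h_inj psiP chiP y0 v0; rewrite raddfD /= (conn_square_gp gf) => e.
have hw : gpm h (m + gpm f' x') = - (y + gpm f v).
  apply/eqP; rewrite -addr_eq0 raddfD /= -e; apply/eqP.
  by rewrite [LHS](AC (2*2) ((3*1)*(4*2))).
have w0 : pi W' (m + gpm f' x') = 0.
  apply: (gp_map_inj (@integral_ghost _ W) h_inj).
  rewrite gp_ghost_map_pi hw !raddfN /= raddfD /= y0 (pi_gpm_eq0 _ v0).
  by rewrite addr0 oppr0 raddf0.
have := residue_char_ker (psi := psi \o gpm h) chiP
  (residue_char_comp h psiP) w0.
rewrite /= hw raddfN !raddfD /= => e'.
by rewrite -[chi m](addrK (chi (gpm f' x'))) e' -!addrA addNKr.
Qed.

Variables (chi1' : {additive gp (cmon W1') -> unit_group k}).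
Variables (chi2' : {additive gp (cmon W2') -> unit_group k}).
Hypothesis chi1'P : residue_char chi1'.
Hypothesis chi2'P : residue_char chi2'.
Hypothesis chi'P : forall x, chi1' (gpm f1' x) = chi2' (gpm f2' x).

Lemma compatible_chars_exist :
  exists (chi1 : {additive gp (cmon W1) -> unit_group k})
         (chi2 : {additive gp (cmon W2) -> unit_group k}),
    [/\ residue_char chi1, residue_char chi2
      & forall x, chi1 (gpm f1 x) = chi2 (gpm f2 x)].
Proof.
have [psi1 psi1P] := residue_char_exists W1.
have [psi2 psi2P] := residue_char_exists W2.
(* The graph of the prescription: residues on units (through [psi1], [psi2]), the given characters
   on elements coming from [W1'] and [W2'], and 0 on the antidiagonal image of [X]. *)
pose G : set ((gp (cmon W1) * gp (cmon W2)) * unit_group k) :=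
  [set z | exists y1 y2 m1 m2 x, [/\ pi W1 y1 = 0, pi W2 y2 = 0 &
    z = ((y1 + gpm g1 m1 + gpm f1 x, y2 + gpm g2 m2 - gpm f2 x),
         psi1 y1 + chi1' m1 + (psi2 y2 + chi2' m2))]].
have G_hom : partial_hom G.
  split.
  - by exists 0, 0, 0, 0, 0; rewrite !raddf0 !addr0.
  - move=> _ _ [y1 [y2 [m1 [m2 [x [y10 y20 ->]]]]]]
        [z1 [z2 [n1 [n2 [w [z10 z20 ->]]]]]].
    exists (y1 - z1), (y2 - z2), (m1 - n1), (m2 - n2), (x - w).
    split; [by rewrite raddfB /= y10 z10 subrr | | ].
      by rewrite raddfB /= y20 z20 subrr.
    have subD (V : zmodType) (a b c d : V) : a + b - (c + d) = (a - c) + (b - d).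
      by rewrite opprD addrACA.
    congr ((_, _), _) => /=.
    + by rewrite (raddfB (gpm g1)) (raddfB (gpm f1)) !subD.
    + rewrite (raddfB (gpm g2)) (raddfB (gpm f2)) [LHS]subD [in LHS]subD.
      by congr (_ + _); rewrite opprB opprK addrC.
    + by rewrite (raddfB psi1) (raddfB psi2) (raddfB chi1') (raddfB chi2') !subD.
  - move=> d [y1 [y2 [m1 [m2 [x [y10 y20 [e1 e2 ->]]]]]]].
    have [x' v0] : exists x', pi X (x - gpm g x') = 0.
      (* Modulo units, [e1] gives [gpm f1 x = - gpm g1 m1] and [e2] gives [gpm f2 x = gpm g2 m2]. *)
      apply: (@theta_lift _ (- m1) m2).
        have := congr1 (pi W1) (esym e1).
        rewrite !raddfD /= y10 add0r raddf0 addrC => /eqP.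
        by rewrite addr_eq0 => /eqP ->; rewrite !raddfN.
      have := congr1 (pi W2) (esym e2).
      rewrite raddfB raddfD /= y20 add0r raddf0 => /eqP.
      by rewrite subr_eq0 => /eqP ->.
    (* With [x] split into a unit [v] and a part from [X'], the values on the two factors are
       opposite: the characters agree on [x'] by [chi'P], and on [v] both equal its residue. *)
    set v := x - gpm g x' in v0; have xE : x = v + gpm g x' by rewrite subrK.
    rewrite xE in e1 e2.
    rewrite (char_relation gf1 g1_inj psi1P chi1'P y10 v0 (esym e1)).
    (* The second factor carries [- x], hence the signs on [v] and [x']. *)
    have e2' : y2 + gpm g2 m2 + gpm f2 (- v + gpm g (- x')) = 0.
      by rewrite raddfN -opprD raddfN -e2.
    have v0' : pi X (- v) = 0 by rewrite raddfN /= v0 oppr0.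
    rewrite (char_relation gf2 g2_inj psi2P chi2'P y20 v0' e2') !raddfN /=.
    rewrite -chi'P -(opprD (psi2 _)) opprK.
    have -> : psi1 (gpm f1 v) = psi2 (gpm f2 v).
      exact: (residue_char_ker (chi := psi1 \o gpm f1) (psi := psi2 \o gpm f2)
        (residue_char_comp f1 psi1P) (residue_char_comp f2 psi2P) v0).
    exact: addNr.
have [chi chiP] := extend_partial_hom (@unit_group_divisible k) G_hom.
pose c1 y := chi (y, 0); pose c2 y := chi (0, y).
have c1_add : zmod_morphism c1.
  by move=> y z; rewrite /c1 -raddfB; congr (chi (_, _)); rewrite subr0.
have c2_add : zmod_morphism c2.
  by move=> y z; rewrite /c2 -raddfB; congr (chi (_, _)); rewrite subr0.
pose a1 := GRing.isZmodMorphism.Build _ _ c1 c1_add.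
pose a2 := GRing.isZmodMorphism.Build _ _ c2 c2_add.
exists (HB.pack_for {additive gp (cmon W1) -> unit_group k} c1 a1).
exists (HB.pack_for {additive gp (cmon W2) -> unit_group k} c2 a2).
have ker W s : calpha W s \is a GRing.unit -> pi W (to_gp s) = 0.
  by move=> us; rewrite gp_map_to_gp /= (ghost_pi_eq0 s).2 ?raddf0.
split=> [s us|s us|x] /=.
- rewrite -psi1P //; congr ug_val; apply: chiP.
  by exists (to_gp s), 0, 0, 0, 0; rewrite !raddf0 !addr0 ker.
- rewrite -psi2P //; congr ug_val; apply: chiP.
  by exists 0, (to_gp s), 0, 0, 0; rewrite !raddf0 !addr0 ker ?add0r.
(* The difference of the two sides is [chi] at an antidiagonal element, where 0 was prescribed. *)
apply/eqP; rewrite -subr_eq0; apply/eqP; rewrite /c1 /c2 -raddfB; apply: chiP.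
exists 0, 0, 0, 0, x; rewrite !raddf0 !addr0; split=> //.
by congr ((_, _), _); rewrite ?add0r // [LHS]subr0.
Qed.

End CompatibleCharacters.

(** * Morphisms from a log point *)

Section LogPointMor.
Variables (k : closedFieldType) (W : conn_log_scheme k) (Q : sharp_fs_monoid).
Variables (h : {additive ghost W -> Q}).
Variables (chi : {additive gp (cmon W) -> unit_group k}).

Definition log_point_mon (m : cmon W) : Q * unit_group k :=
  (h (ghost_pi m), chi (to_gp m)).

Lemma log_point_mon_additive : nmod_morphism log_point_mon.
Proof.
split=> [|x y]; rewrite /log_point_mon; first by rewrite !raddf0.
by rewrite !raddfD.
Qed.

HB.instance Definition _ := GRing.isNmodMorphism.Build (cmon W)
  (Q * unit_group k)%type log_point_mon log_point_mon_additive.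

Hypothesis h_local : forall q, h q = 0 -> q = 0.
Hypothesis chiP : residue_char chi.

(** If [h] kills the ghost of [m], locality puts [m] over a unit and [chiP] applies; otherwise [m]
    lies over a nonunit and both sides vanish. *)
Lemma log_point_mor_alpha m :
  log_point_alpha (log_point_mon m) = @residue _ W (calpha W m).
Proof.
rewrite /log_point_alpha /=; have [/h_local/ghost_pi_eq0 um|hm] := eqVneq (h _) 0.
  exact: chiP.
apply/esym/eqP; rewrite residue_eq0; apply: contra_neqN hm => /ghost_pi_eq0 ->.
exact: raddf0.
Qed.

Definition log_point_mor : conn_mor (log_point k Q) W :=
  @ConnMor k (log_point k Q) W (@residue k W) log_point_mon log_point_mor_alpha.

End LogPointMor.

(** * The natural numbers as a sharp fs monoid *)

Lemma nat_mulrn (a n : nat) : a *+ n = (a * n)%N.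
Proof. by elim: n => [|n IHn]; rewrite ?muln0 // mulrS IHn mulnS. Qed.

Lemma nat_integral : integral_monoid nat.
Proof. exact: addIn. Qed.

Lemma nat_fs_monoid : fs_monoid nat.
Proof.
split=> [|| x n n_gt0 [y]]; first exact: nat_integral.
  exists 1%N, (fun=> 1%N) => x; exists (fun=> x).
  by rewrite big_ord1 nat_mulrn mul1n.
have [a [b ->]] := gpE x; rewrite mulrnBl -!raddfMn => /eqP.
rewrite subr_eq -raddfD => /eqP/(to_gp_inj nat_integral).
(* The truncated subtraction is a true difference: [abn] forces [b <= a], as [n] is positive. *)
rewrite !nat_mulrn => abn; exists (a - b)%N; apply/eqP.
rewrite subr_eq -raddfD [_ + _]subnK // -(leq_pmul2r n_gt0) abn.
exact: leq_addl.
Qed.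

Lemma nat_sharp : sharp_monoid nat.
Proof. by move=> x y /eqP; rewrite [x + y == _]addn_eq0 => /andP[/eqP]. Qed.

Definition nat_sharp_fs := SharpFsMonoid nat_fs_monoid nat_sharp.

(** * Existence of a point of the fibre product *)

Unset Implicit Arguments.

Theorem lemma3p4 (R : realType) (kappa : closedFieldType)
  (char0 : [pchar kappa] =i pred0)
  (W1 W2 X : conn_log_scheme kappa) (f1 : conn_mor W1 X) (f2 : conn_mor W2 X)
  (W1' W2' X' : conn_log_scheme kappa)
  (W1'_pt : is_log_point W1') (W2'_pt : is_log_point W2')
  (X'_pt : is_log_point X')
  (f1' : conn_mor W1' X') (f2' : conn_mor W2' X')
  (g1 : conn_mor W1 W1') (g2 : conn_mor W2 W2') (g : conn_mor X X')
  (gf1 : conn_comp g f1 = conn_comp f1' g1)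
  (gf2 : conn_comp g f2 = conn_comp f2' g2)
  (* (1) *)
  (F' : log_scheme kappa) (p1' : log_mor F' W1') (p2' : log_mor F' W2')
  (F'_prod : is_fs_fibre_product f1' f2' p1' p2')
  (F'_nonempty : nonempty_scheme F')
  (* (2) *)
  (dual1 : [set h.1 | h in dual_fibre_product (ghost_map f1) (ghost_map f2)]
             `&` interior_dual R !=set0)
  (dual2 : [set h.2 | h in dual_fibre_product (ghost_map f1) (ghost_map f2)]
             `&` interior_dual R !=set0)
  (* (3) *)
  (g_inj : injective (ghost_map g))
  (g1_inj : injective (ghost_map g1))
  (g2_inj : injective (ghost_map g2))
  (theta_inj : injective (fun x : coker (gp_map (ghost_map g)) =>
     (coker_map (gp_map (ghost_map g1)) (gp_map (ghost_map f1)) x,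
      coker_map (gp_map (ghost_map g2)) (fun y => - gp_map (ghost_map f2) y) x)))
  (F : log_scheme kappa) (p1 : log_mor F W1) (p2 : log_mor F W2)
  (F_prod : is_fs_fibre_product f1 f2 p1 p2) :
  nonempty_scheme F.
Proof.
have [comm' _] := F'_prod; have [s] := F'_nonempty.
pose q1 : conn_mor (germ F' s) W1' := mor_germ p1' s.
pose q2 : conn_mor (germ F' s) W2' := mor_germ p2' s.
have q_comm : conn_comp f1' q1 = conn_comp f2' q2.
  exact: (congr1 (fun u : log_mor F' X' =>
    mor_germ u s : conn_mor (germ F' s) X') comm').
(* Pulling back a single character of the germ at [s] along [q1] and [q2] makes the two characters
   compatible on [X']. *)
have [chi0 chi0P] := residue_char_exists (germ F' s).
have chi_comm x : chi0 (gp_map (cmor_mon q1) (gp_map (cmor_mon f1') x)) =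
    chi0 (gp_map (cmor_mon q2) (gp_map (cmor_mon f2') x)).
  congr (chi0 _); apply: gp_map_square => m.
  exact: (congr1 (fun q => cmor_mon q m) q_comm).
have [chi1 [chi2 [chi1P chi2P chiP]]] := compatible_chars_exist gf1 gf2 g1_inj
  g2_inj theta_inj (residue_char_comp q1 chi0P) (residue_char_comp q2 chi0P) chi_comm.
have [_ [[[a1 a2] aP <-] a_int]] := dual1.
have [_ [[[b1 b2] bP <-] b_int]] := dual2.
(* [a1] is interior on the first factor and [b2] on the second. A sum of natural numbers vanishes
   only if both terms do, so [h1] and [h2] are local. *)
pose h1 : {additive ghost W1 -> nat_sharp_fs} := a1 \+ b1.
pose h2 : {additive ghost W2 -> nat_sharp_fs} := a2 \+ b2.
have h1_local q : h1 q = 0 -> q = 0.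
  move=> /nat_sharp; apply: interior_dual_eq0 a_int.
    exact: integral_ghost.
  exact: sharp_ghost.
have h2_local q : h2 q = 0 -> q = 0.
  rewrite /h2 /= addrC => /nat_sharp; apply: interior_dual_eq0 b_int.
    exact: integral_ghost.
  exact: sharp_ghost.
pose r1 := log_point_mor h1_local chi1P; pose r2 := log_point_mor h2_local chi2P.
have r_comm : conn_comp f1 r1 = conn_comp f2 r2.
  apply: conn_mor_ext => [a|m] /=; first by rewrite !residue_cmor.
  rewrite /log_point_mon -!ghost_map_pi -!gp_map_to_gp chiP; congr pair.
  by rewrite /= aP bP.
have [_ univ] := F_prod.
(* The compatible maps from the standard log point factor through [F]; the image of its point is a
   point of [F]. *)
have [|u _] := univ _ (log_mor_of_conn r1) (log_mor_of_conn r2).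
  exact: (congr1 (@log_mor_of_conn _ _ _) r_comm).
exact: (inhabits (mor_points u tt)).
Qed.
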